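(* Let $E$ be a normed space and let $f \in K_C(E)$. Then $f$ is isolated if and only if it is both local and $\partial$-extreme.
   Context: All spaces are real. For a metric space $X$, a Katětov function on $X$ is a function $f \colon X \to \mathbb{R}$ with $f(x) \leq f(y) + d(x,y)$ and $d(x,y) \leq f(x) + f(y)$ for all $x,y \in X$; $K(X)$ is the set of these. If $X$ is a normed space or a convex subset of one, $K_C(X)$ is the set of convex Katětov functions on $X$. It carries two structures: the topology of point-wise convergence and the distance of uniform convergence (supremum distance). (The space $K_C(E)$ is identified, as a topological and as a metric space, with the space $S_1(E)$ of $1$-types over $E$, i.e., of semi-norms on $E \oplus \mathbb{R}x$ extending the norm of $E$, a semi-norm $\|\cdot\|^\xi$ corresponding to $a \mapsto \|x-a\|^\xi$.) $f \in K_C(E)$ is isolated if every neighbourhood of $f$ in $K_C(E)$ for the supremum distance is also a neighbourhood of $f$ for the topology of point-wise convergence. For $X \subseteq E$ convex and $f \in K_C(X)$, the function $\tilde f(y) = \inf_{x \in X} f(x) + \|x-y\|$ is an extension of $f$ belonging to $K_C(E)$. A function $f \in K_C(E)$ is local if there are $f_k \in K_C(X_k)$ ($k \in \mathbb{N}$), where each $X_k \subseteq E$ is nonempty, convex and compact, such that $\tilde f_k \to f$ uniformly on $E$. For $f \in K_C(E)$, its conjugate is $f^* \colon E^* \to (-\infty,+\infty]$, $f^*(\lambda) = \sup_{v \in E} \lambda v - f(v)$. Let $B(E^* ) = \{\lambda \in E^* : \|\lambda\| \leq 1\}$ and $\partial B(E^* ) = \{\lambda \in E^*: \|\lambda\|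 = 1\}$. A function $f \in K_C(E)$ is $\partial$-extreme if for every $g \in K_C(E)$ with $g \leq f$ one has $g^* \leq f^*$ on $\partial B(E^* )$. *)

(* Defs.v *)
From HB Require Import structures.
From mathcomp Require Import all_boot all_order all_algebra.
From mathcomp Require Import all_classical all_reals all_analysis.

Set Implicit Arguments.
Unset Strict Implicit.
Unset Printing Implicit Defensive.

Import Order.TTheory GRing.Theory Num.Theory.
Import numFieldNormedType.Exports.

Local Open Scope classical_set_scope.
Local Open Scope ring_scope.

Section KatetovFunctions.
Context (R : realType) (E : normedModType R).
Implicit Types (X : set E) (f g : E -> R) (l : {linear E -> R^o}).

(* A real function on a subset X of E is represented by a total function
   E -> R whose values outside of X are ignored. *)
Definition katetov X f : Prop :=
  forall x y, X x -> X y ->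
    f x <= f y + `|x - y| /\ `|x - y| <= f x + f y.

Definition KC X : set (E -> R) :=
  [set f | katetov X f /\ convex_function X f].

Definition sup_dist f g : \bar R :=
  ereal_sup [set `|f x - g x|%:E | x in [set: E]].

Definition sup_nbhs f (N : set (E -> R)) : Prop :=
  exists2 e : R, 0 < e &
    forall g, KC [set: E] g -> (sup_dist f g < e%:E)%E -> N g.

(* Neighbourhoods in the subspace KC [set: E] of {ptws E -> R}; as in sup_nbhs,
   only the trace of N on KC [set: E] matters. *)
Definition pointwise_nbhs f (N : set (E -> R)) : Prop :=
  within (KC [set: E]) (nbhs (f : {ptws E -> R})) N.

Definition KC_isolated f : Prop :=
  forall N : set (E -> R), sup_nbhs f N -> pointwise_nbhs f N.

Definition inf_extension X f : E -> R :=
  fun y => inf [set f x + `|x - y| | x in X].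

Definition KC_local f : Prop :=
  exists (X_ : nat -> set E) (f_ : nat -> E -> R),
    (forall k, [/\ X_ k !=set0, convex_set (X_ k), compact (X_ k)
                 & KC (X_ k) (f_ k)]) /\
    {uniform, (fun k => inf_extension (X_ k) (f_ k)) @ \oo --> f}.

Definition conjugate f l : \bar R :=
  ereal_sup [set (l v - f v)%:E | v in [set: E]].

Definition dual_norm l : R := sup [set `|l v| | v in [set v : E | `|v| <= 1]].

(* The elements of the topological dual are the continuous l; continuity also
   ensures that the supremum defining dual_norm l is that of a bounded set. *)
Definition dual_sphere : set {linear E -> R^o} :=
  [set l : {linear E -> R^o} | continuous l /\ dual_norm l = 1].

Definition boundary_extreme f : Prop :=
  forall g, KC [set: E] g -> (forall x, g x <= f x) ->
    forall l, dual_sphere l -> (conjugate g l <= conjugate f l)%E.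

End KatetovFunctions.

(* Main.v *)
Require Import Defs.
From HB Require Import structures.
From mathcomp Require Import all_boot all_order all_algebra.
From mathcomp Require Import all_classical all_reals all_analysis.
From mathcomp Require Import ring lra.
Import Order.TTheory GRing.Theory Num.Theory.
Import numFieldNormedType.Exports.
Local Open Scope classical_set_scope.
Local Open Scope ring_scope.

Set Implicit Arguments.
Unset Strict Implicit.
Unset Printing Implicit Defensive.

(** Isolated implies local. For a polytope X containing 0, the extension of
    the restriction of f to X is a convex Katetov function that agrees with f
    on X. Along the polytopes spanned by larger and larger finite sets these
    extensions tend to f point-wise, hence come uniformly close to f when f is
    isolated, and polytopes are compact ([isolated_local]).

    Isolated implies boundary-extreme. If g <= f, the functions
    max (g, (1 - eta) f) are convex Katetov and tend to f point-wise as eta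
    tends to 0, so one of them is uniformly close to f. Far from the origin it
    equals g, because g grows with slope 1 while (1 - eta) f grows with slope
    1 - eta. So g is close to f far away, and far away is where the conjugate
    at a functional of norm 1 can be computed: moving a point along a direction
    where the functional l nearly attains its norm does not decrease l - g
    significantly ([isolated_boundary_extreme]).

    Local and boundary-extreme implies isolated. Locality says that up to e,
    f is the infimum of f x + |x - y| over x in some compact convex X. Let g
    be convex Katetov and close to f on the compact set [0, T] X, where T is
    large. Then g <= f + 2 e everywhere, since g is 1-Lipschitz. For the
    converse, write F* and G* for the conjugates of f and g; it is enough to
    show G* <= F* + 3 e on the unit ball, at the slope l of a supporting
    functional of f.
    - On the unit sphere, G* <= F* + d whenever g <= f + d: the convex hull of
      min (f, g + d) is again a convex Katetov function and lies below f, so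
      extremality applies to it ([boundary_extreme_approx]).
    - Near l, there is m with G* m <= F* l + e and m >= l - e on X: a
      Hahn-Banach argument, where the closeness of g and f on [0, T] X serves
      for t x with t <= T, and the growth of g for t > T
      ([separating_functional]).
    - The ray from m through l leaves the ball at some n of norm 1, with
      (1 + r) l = n + r m, and locality bounds F* n by F* l + e + r e.
      Convexity of G* along this ray concludes
      ([local_boundary_extreme_isolated]). *)

(** * Subgradients of convex functions *)

Section Infima.
Context (R : realType) (T : Type) (A : set T) (F : T -> R).

Lemma inf_image_le (m : R) (a : T) :
  (forall b, A b -> m <= F b) -> A a -> inf [set F b | b in A] <= F a.
Proof.
move=> mF Aa; apply: ge_inf; last by exists a.
by exists m => _ [b Ab <-]; exact: mF.
Qed.

Lemma le_inf_image (m : R) (a : T) :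
  A a -> (forall b, A b -> m <= F b) -> m <= inf [set F b | b in A].
Proof.
move=> Aa mF; apply: lb_le_inf; first by exists (F a), a.
by move=> _ [b Ab <-]; exact: mF.
Qed.

Lemma inf_image_lt (m e : R) (a : T) : A a -> (forall b, A b -> m <= F b) ->
  0 < e -> exists2 b, A b & F b < inf [set F b | b in A] + e.
Proof.
move=> Aa mF e0.
have [|_ [b Ab <-] Fb] := inf_adherent e0 (E := [set F b | b in A]).
  split; first by exists (F a), a.
  by exists m => _ [b Ab <-]; exact: mF.
by exists b.
Qed.

End Infima.

Section Subgradients.
Context (R : realType) (E : lmodType R).
Implicit Types (h p q r : E -> R).

Definition convexT h := forall (t : R) x y, 0 <= t -> t <= 1 ->
  h (t *: x + (1 - t) *: y) <= t * h x + (1 - t) * h y.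

Definition sublinear p :=
  (forall t x, 0 < t -> p (t *: x) <= t * p x) /\
  (forall x y, p (x + y) <= p x + p y).

Lemma sublinear0 p : sublinear p -> p 0 = 0.
Proof.
move=> [ph pD]; have := pD 0 0; have := ph 2^-1 0; rewrite scaler0 addr0.
by move=> /(_ ltac:(lra)); lra.
Qed.

Lemma sublinear_ge p x : sublinear p -> - p (- x) <= p x.
Proof. by move=> sp; have := sp.2 x (- x); rewrite subrr sublinear0//; lra. Qed.

Lemma sublinearZ p t x : sublinear p -> 0 <= t -> p (t *: x) = t * p x.
Proof.
move=> sp; rewrite le_eqVlt => /orP[/eqP<-|t0].
  by rewrite scale0r mul0r sublinear0.
apply/eqP; rewrite eq_le sp.1//=.
have := sp.1 t^-1 (t *: x); rewrite scalerA mulVf ?gt_eqF// scale1r invr_gt0.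
by move=> /(_ t0); rewrite ler_pdivlMl.
Qed.

(** Zorn's lemma for the reversed order: the infimum of a chain of sublinear
    functions is finite because q x >= - q (- x) >= - p (- x). *)
Lemma minimal_sublinear p : sublinear p ->
  exists q, [/\ sublinear q, forall x, q x <= p x &
    forall r, sublinear r -> (forall x, r x <= q x) -> r = q].
Proof.
move=> sp.
pose T := {q : E -> R | sublinear q /\ forall x, q x <= p x}.
pose above (q r : T) := `[< forall x, sval r x <= sval q x >].
have [| | | |[q [sq qp]] qmin] := @Zorn T above.
- by move=> q; apply/asboolP.
- move=> q r s /asboolP qr /asboolP rs; apply/asboolP => x.
  exact: le_trans (rs x) (qr x).
- move=> [q sq] [r sr] /asboolP/= qr /asboolP/= rq; apply: eq_exist.
  by apply/funext => x; apply/eqP; rewrite eq_le qr rq.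
- move=> A Atot.
  have [[a Aa]|A0] := pselect (A !=set0); last first.
    have sp' : sublinear p /\ forall x, p x <= p x by [].
    by exists (exist _ p sp') => s As; case: A0; exists s.
  pose ev x (q : T) := sval q x.
  have lb x (q : T) : A q -> - p (- x) <= ev x q.
    case: q => q [sq qp] _; rewrite /ev /=.
    by rewrite (le_trans _ (sublinear_ge _ sq))// lerN2.
  pose m x := inf [set ev x q | q in A].
  have mle x (q : T) : A q -> m x <= ev x q by move=> Aq; exact: inf_image_le (lb x) Aq.
  have sm : sublinear m.
    split=> [t x t0|x y].
      rewrite -ler_pdivrMl//; apply: le_inf_image Aa _ => q Aq.
      rewrite ler_pdivrMl// (le_trans (mle _ _ Aq))// /ev.
      exact: (svalP q).1.1.
    apply/ler_addgt0Pr => e e0; have e20 : 0 < e / 2 by rewrite divr_gt0.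
    have [q Aq qx] := inf_image_lt Aa (lb x) e20.
    have [r Ar ry] := inf_image_lt Aa (lb y) e20.
    rewrite -/(m x) -/(m y) in qx ry.
    have [s [As sqx sry]] : exists s, [/\ A s, ev x s <= ev x q & ev y s <= ev y r].
      have [/asboolP qr|/asboolP rq] := Atot _ _ Aq Ar.
        by exists r; split=> //; exact: qr.
      by exists q; split=> //; exact: rq.
    have := mle (x + y) _ As; have := (svalP s).1.2 x y.
    by move: qx ry sqx sry; rewrite /ev; lra.
  have mp x : m x <= p x by rewrite (le_trans (mle x a Aa))//; exact: (svalP a).2.
  by exists (exist _ m (conj sm mp)) => s As; apply/asboolP => x; exact: mle.
exists q; split=> // r sr rq.
have rp x : r x <= p x := le_trans (rq x) (qp x).
have := qmin (exist _ r (conj sr rp)).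
by move=> /(_ _)/(congr1 sval)/=-> //; apply/asboolP.
Qed.

(** For fixed v, the infimum over t >= 0 of q (x + t v) - t q v is sublinear
    and below q, so it equals q by minimality; t = 1 gives additivity. *)
Lemma minimal_sublinear_additive q : sublinear q ->
  (forall r, sublinear r -> (forall x, r x <= q x) -> r = q) ->
  forall x y, q (x + y) = q x + q y.
Proof.
move=> sq qmin x v; apply/eqP; rewrite eq_le sq.2/=.
pose F w t := q (w + t *: v) - t * q v.
have lb w t : 0 <= t -> - q (- w) <= F w t.
  move=> t0; have := sq.2 (w + t *: v) (- w).
  by rewrite addrAC subrr add0r sublinearZ// /F; lra.
pose r w := inf [set F w t | t in [set t : R | 0 <= t]].
have r_le w t : 0 <= t -> r w <= F w t.
  by move=> t0; exact: inf_image_le (lb w) t0.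
have z0 : [set t : R | 0 <= t] 0 by rewrite /=.
have rq : r = q.
  apply: qmin => [|w].
    split=> [s w s0|w w'].
      rewrite -ler_pdivrMl//; apply: le_inf_image z0 _ => t t0.
      rewrite ler_pdivrMl// (le_trans (r_le _ (s * t) _)) ?mulr_ge0 ?(ltW s0)//.
      by rewrite /F -scalerA -scalerDr (sublinearZ _ sq (ltW s0)); lra.
    apply/ler_addgt0Pr => e e0; have e20 : 0 < e / 2 by rewrite divr_gt0.
    have [t t0 tx] := inf_image_lt z0 (lb w) e20.
    have [s s0 sx] := inf_image_lt z0 (lb w') e20.
    rewrite -/(r w) -/(r w') in tx sx.
    have := r_le (w + w') (t + s) (addr_ge0 t0 s0).
    have := sq.2 (w + t *: v) (w' + s *: v).
    by rewrite /F scalerDl addrACA in tx sx *; lra.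
  by rewrite (le_trans (r_le w 0 _))// /F scale0r addr0 mul0r subr0.
by have := r_le x 1 ler01; rewrite rq /F scale1r mul1r; lra.
Qed.

Lemma sublinear_dominates p : sublinear p ->
  exists l : {linear E -> R^o}, forall x, l x <= p x.
Proof.
move=> /minimal_sublinear[q [sq qp /(minimal_sublinear_additive sq) qD]].
have qN x : q (- x) = - q x.
  by have := qD x (- x); rewrite subrr sublinear0//; lra.
have lin : linear (q : E -> R^o).
  move=> a x y; rewrite qD; congr (_ + _).
  have [a0|a0] := leP 0 a; first exact: sublinearZ.
  rewrite -[a]opprK scaleNr qN sublinearZ ?oppr_ge0 ?ltW//.
  by rewrite scaleNr.
pose L := GRing.isLinear.Build R E R^o *:%R q lin.
by exists (HB.pack_for {linear E -> R^o} q L).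
Qed.

(** The one-sided directional derivative of h at a is sublinear; any linear
    functional below it is a subgradient. *)
Lemma convexT_subgradient h a : convexT h ->
  exists l : {linear E -> R^o}, forall x, h a + l (x - a) <= h x.
Proof.
move=> ch.
pose F w t := (h (a + t *: w) - h a) / t.
pose p w := inf [set F w t | t in [set t : R | 0 < t]].
have lb w t : 0 < t -> h a - h (a - w) <= F w t.
  move=> t0; rewrite /F ler_pdivlMr//.
  have t1 : 0 < 1 + t by lra.
  have := ch (1 + t)^-1 (a + t *: w) (a - w).
  have -> : (1 + t)^-1 *: (a + t *: w) + (1 - (1 + t)^-1) *: (a - w) = a.
    have -> : 1 - (1 + t)^-1 = (1 + t)^-1 * t by field; lra.
    rewrite -scalerA -scalerDr scalerBr addrACA -{1}[a]scale1r addrA.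
    rewrite addrAC -addrA addrA.
    rewrite -scalerDl addrAC addrK scalerA mulVf ?scale1r//; lra.
  have -> : (1 + t)^-1 * h (a + t *: w) + (1 - (1 + t)^-1) * h (a - w) =
    (h (a + t *: w) + t * h (a - w)) / (1 + t) by field; lra.
  rewrite ler_pdivlMr// invr_ge0 invf_le1//.
  by move=> /(_ (ltW t1) ltac:(lra)); lra.
have p_le w t : 0 < t -> p w <= F w t.
  by move=> t0; exact: inf_image_le (lb w) t0.
have z1 : [set t : R | 0 < t] 1 by rewrite /=.
have sp : sublinear p.
  split=> [s w s0|w w'].
    rewrite -ler_pdivrMl//; apply: le_inf_image z1 _ => t t0.
    rewrite ler_pdivrMl// (le_trans (p_le _ (t / s) _)) ?divr_gt0//.
    rewrite /F scalerA -mulrA mulVf ?mulr1 ?gt_eqF//.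
    by rewrite invf_div mulrCA.
  apply/ler_addgt0Pr => e e0; have e20 : 0 < e / 2 by rewrite divr_gt0.
  have [t t0 tx] := inf_image_lt z1 (lb w) e20.
  have [s s0 sx] := inf_image_lt z1 (lb w') e20.
  rewrite -/(p w) -/(p w') in tx sx; rewrite /= in t0 s0.
  have ts0 : 0 < t + s by lra.
  suff : p (w + w') <= F w t + F w' s by lra.
  have k0 : 0 < t * s / (t + s) by rewrite divr_gt0 ?mulr_gt0.
  apply: le_trans (p_le _ _ k0) _; rewrite /F ler_pdivrMr//.
  have := ch (s / (t + s)) (a + t *: w) (a + s *: w').
  have -> : (s / (t + s)) *: (a + t *: w) + (1 - s / (t + s)) *: (a + s *: w')
    = a + (t * s / (t + s)) *: (w + w').
    rewrite !scalerDr addrACA -scalerDl [s / _ + _]addrC subrK scale1r !scalerA.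
    by congr (_ + (_ *: _ + _ *: _)); field; lra.
  have k_ge0 : 0 <= s / (t + s) by rewrite divr_ge0// ltW.
  have k_le1 : s / (t + s) <= 1 by rewrite ler_pdivrMr//; lra.
  move=> /(_ k_ge0 k_le1).
  set u := h (_ + t *: w); set u' := h (_ + s *: w').
  have -> : s / (t + s) * u + (1 - s / (t + s)) * u' =
     ((u - h a) / t + (u' - h a) / s) * (t * s / (t + s)) + h a by field; lra.
  lra.
have [l lp] := sublinear_dominates sp.
exists l => x; have := le_trans (lp (x - a)) (p_le (x - a) 1 z1).
by rewrite /F scale1r [a + _]addrC subrK divr1; lra.
Qed.

End Subgradients.

(** * Convex Katetov functions: extensions, convex hulls, maxima *)

Section KatetovBasics.
Context (R : realType) (E : normedModType R).
Implicit Types (X : set E) (f g h k : E -> R) (x y z : E) (s t : R).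

Lemma convex_setP X : convex_set X <->
  forall t x y, 0 <= t -> t <= 1 -> X x -> X y -> X (t *: x + (1 - t) *: y).
Proof.
split=> [cX t x y t0 t1 Xx Xy|cX x y t].
  by have := cX x y (Itv01 t0 t1); rewrite !inE; apply.
by rewrite !inE; apply: cX.
Qed.

Lemma convex_functionP X f : convex_function X f <->
  forall t x y, 0 <= t -> t <= 1 -> X x -> X y ->
    f (t *: x + (1 - t) *: y) <= t * f x + (1 - t) * f y.
Proof.
split=> [cf t x y t0 t1 Xx Xy|cf t x y].
  by have := cf (Itv01 t0 t1) x y; rewrite !inE; apply.
by rewrite !inE => Xx Xy; apply: cf.
Qed.

Lemma KC_TP f : KC [set: E] f <->
  [/\ forall x y, f x <= f y + `|x - y|,
      forall x y, `|x - y| <= f x + f y & convexT f].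
Proof.
split=> [[kf /convex_functionP cf]|[fL fK cf]].
  split=> [x y|x y|t x y t0 t1]; first exact: (kf x y I I).1.
    exact: (kf x y I I).2.
  exact: cf.
split=> [x y _ _|]; first by split.
by apply/convex_functionP => t x y t0 t1 _ _; exact: cf.
Qed.

Lemma katetov_ge0 X f x : katetov X f -> X x -> 0 <= f x.
Proof. by move=> kf Xx; have := (kf x x Xx Xx).2; rewrite subrr normr0; lra. Qed.

Lemma norm_conv t x y : 0 <= t -> t <= 1 ->
  `|t *: x + (1 - t) *: y| <= t * `|x| + (1 - t) * `|y|.
Proof.
move=> t0 t1; rewrite (le_trans (ler_normD _ _))// !normrZ !ger0_norm//.
by rewrite subr_ge0.
Qed.

Lemma conv_sub t x y x' y' : (t *: x + (1 - t) *: y) - (t *: x' + (1 - t) *: y')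
  = t *: (x - x') + (1 - t) *: (y - y').
Proof. by rewrite !scalerBr opprD addrACA. Qed.

Section InfExtension.
Variables (X : set E) (f : E -> R) (a : E).
Hypotheses (Xa : X a) (fX : KC X f).

Lemma inf_extension_le x y : X x -> inf_extension X f y <= f x + `|x - y|.
Proof.
apply: (inf_image_le (F := fun x => f x + `|x - y|) (m := 0)) => b Xb.
by rewrite addr_ge0// (katetov_ge0 fX.1).
Qed.

Lemma le_inf_extension c y :
  (forall x, X x -> c <= f x + `|x - y|) -> c <= inf_extension X f y.
Proof. exact: (le_inf_image Xa). Qed.

Lemma inf_extension_lt e y : 0 < e ->
  exists2 x, X x & f x + `|x - y| < inf_extension X f y + e.
Proof.
apply: (inf_image_lt Xa (F := fun x => f x + `|x - y|) (m := 0)) => b Xb.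
by rewrite addr_ge0// (katetov_ge0 fX.1).
Qed.

Lemma inf_extension_id x : X x -> inf_extension X f x = f x.
Proof.
move=> Xx; apply/eqP; rewrite eq_le; apply/andP; split.
  by have := inf_extension_le x Xx; rewrite subrr normr0 addr0.
by apply: le_inf_extension => y Xy; rewrite distrC; exact: (fX.1 x y Xx Xy).1.
Qed.

Lemma KC_inf_extension : convex_set X -> KC [set: E] (inf_extension X f).
Proof.
move=> /convex_setP cX; have [kf /convex_functionP cf] := fX.
apply/KC_TP; split=> [y y'|y y'|t y y' t0 t1].
- rewrite -lerBlDr; apply: le_inf_extension => x Xx.
  have := inf_extension_le y Xx; have := ler_distD y' x y.
  by rewrite (distrC y'); lra.
- apply/ler_addgt0Pr => e e0; have e20 : 0 < e / 2 by rewrite divr_gt0.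
  have [x Xx xy] := inf_extension_lt y e20.
  have [x' Xx' xy'] := inf_extension_lt y' e20.
  have := (kf _ _ Xx Xx').2; have := ler_distD x y y'; have := ler_distD x' x y'.
  by rewrite (distrC y x); lra.
- apply/ler_addgt0Pr => e e0.
  have [x Xx xy] := inf_extension_lt y e0.
  have [x' Xx' xy'] := inf_extension_lt y' e0.
  have := inf_extension_le (t *: y + (1 - t) *: y') (cX _ _ _ t0 t1 Xx Xx').
  rewrite conv_sub; have := norm_conv (x - y) (x' - y') t0 t1.
  have := cf _ _ _ t0 t1 Xx Xx'.
  have := ler_wpM2l t0 (ltW xy).
  have : 0 <= 1 - t by lra.
  by move=> /ler_wpM2l/(_ _ _ (ltW xy')); lra.
Qed.

End InfExtension.

Section ConvexHull.
Variable k : E -> R.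

(** The convex hull of the graph of k, generated by binary combinations, so
    that facts about the convex hull of k follow by induction. *)
Inductive hull_epigraph : E -> R -> Prop :=
| hull_epigraph_base x : hull_epigraph x (k x)
| hull_epigraph_conv t x y a b : 0 <= t -> t <= 1 ->
    hull_epigraph x a -> hull_epigraph y b ->
    hull_epigraph (t *: x + (1 - t) *: y) (t * a + (1 - t) * b).

Definition convex_hull_fun x : R := inf [set a | a in hull_epigraph x].

Hypothesis kL : forall x y, k x <= k y + `|x - y|.
Hypothesis kK : forall x y, `|x - y| <= k x + k y.

(** The inequality holds on the graph of k; its left side is convex and its
    right side affine in each of the two points of the epigraph. *)
Lemma hull_epigraph_katetov x y a b :
  hull_epigraph x a -> hull_epigraph y b -> `|x - y| <= a + b.
Proof.
move=> xa; elim: xa y b => {x a} [x|t x x' a a' t0 t1 _ IH _ IH'] y b yb.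
  elim: yb => {y b} [y|t y y' b b' t0 t1 _ IH _ IH']; first exact: kK.
  have -> : x - (t *: y + (1 - t) *: y') = t *: (x - y) + (1 - t) *: (x - y').
    by rewrite -conv_sub -scalerDl (addrC t) subrK scale1r.
  apply: le_trans (norm_conv _ _ t0 t1) _.
  have := ler_wpM2l t0 IH; have : 0 <= 1 - t by lra.
  by move=> /ler_wpM2l/(_ _ _ IH'); lra.
have -> : t *: x + (1 - t) *: x' - y = t *: (x - y) + (1 - t) *: (x' - y).
  by rewrite -conv_sub -[in RHS]scalerDl (addrC t) subrK scale1r.
apply: le_trans (norm_conv _ _ t0 t1) _.
have := ler_wpM2l t0 (IH _ _ yb); have : 0 <= 1 - t by lra.
by move=> /ler_wpM2l/(_ _ _ (IH' _ _ yb)); lra.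
Qed.

Lemma hull_epigraph_translate x a z : hull_epigraph x a ->
  exists2 b, hull_epigraph (x + z) b & b <= a + `|z|.
Proof.
elim=> {x a} [x|t x x' a a' t0 t1 _ [b xb ab] _ [b' xb' ab']].
  exists (k (x + z)); first exact: hull_epigraph_base.
  by have := kL (x + z) x; rewrite addrAC subrr add0r.
exists (t * b + (1 - t) * b').
  have -> : t *: x + (1 - t) *: x' + z = t *: (x + z) + (1 - t) *: (x' + z).
    by rewrite !scalerDr addrACA -[in RHS]scalerDl (addrC t) subrK scale1r.
  exact: hull_epigraph_conv.
have := ler_wpM2l t0 ab; have : 0 <= 1 - t by lra.
by move=> /ler_wpM2l/(_ _ _ ab'); lra.
Qed.

Let hull_ge0 x a : hull_epigraph x a -> 0 <= a.
Proof.
by move=> xa; have := hull_epigraph_katetov xa xa; rewrite subrr normr0; lra.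
Qed.

Lemma convex_hull_fun_le x a : hull_epigraph x a -> convex_hull_fun x <= a.
Proof. exact: (inf_image_le (F := id) (@hull_ge0 x)). Qed.

Let convex_hull_fun_lt e x : 0 < e ->
  exists2 a, hull_epigraph x a & a < convex_hull_fun x + e.
Proof. exact: (inf_image_lt (F := id) (hull_epigraph_base x) (@hull_ge0 x)). Qed.

Lemma KC_convex_hull_fun : KC [set: E] convex_hull_fun.
Proof.
apply/KC_TP; split=> [x y|x y|t x y t0 t1]; apply/ler_addgt0Pr => e e0.
- have [b yb] := convex_hull_fun_lt y e0.
  have [a] := hull_epigraph_translate (x - y) yb.
  by rewrite addrC subrK => /convex_hull_fun_le; lra.
- have e20 : 0 < e / 2 by rewrite divr_gt0.
  have [a xa] := convex_hull_fun_lt x e20.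
  have [b yb] := convex_hull_fun_lt y e20.
  by have := hull_epigraph_katetov xa yb; lra.
- have [a xa ax] := convex_hull_fun_lt x e0.
  have [b yb bx] := convex_hull_fun_lt y e0.
  have := convex_hull_fun_le (hull_epigraph_conv t0 t1 xa yb).
  have := ler_wpM2l t0 (ltW ax); have : 0 <= 1 - t by lra.
  by move=> /ler_wpM2l/(_ _ _ (ltW bx)); lra.
Qed.

End ConvexHull.

Lemma KC_max f g : KC [set: E] f ->
  (forall x y, g x <= g y + `|x - y|) -> convexT g ->
  KC [set: E] (fun x => Num.max (f x) (g x)).
Proof.
move=> /KC_TP[fL fK cf] gL cg; apply/KC_TP; split=> [x y|x y|t x y t0 t1].
- have := fL x y; have := gL x y.
  by rewrite ge_max; case: (leP (f y)); lra.
- by have := fK x y; rewrite !maxEle; do 2 case: ifPn => *; lra.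
- have := cf t x y t0 t1; have := cg t x y t0 t1.
  have t10 : 0 <= 1 - t by lra.
  have mf z : f z <= Num.max (f z) (g z) by rewrite le_max lexx.
  have mg z : g z <= Num.max (f z) (g z) by rewrite le_max lexx orbT.
  have := ler_wpM2l t0 (mf x); have := ler_wpM2l t0 (mg x).
  have := ler_wpM2l t10 (mf y); have := ler_wpM2l t10 (mg y).
  by rewrite ge_max; lra.
Qed.

End KatetovBasics.

(** * Functionals in the dual unit ball *)

(** Used to read off a bound on slopes from a bound at infinity. *)
Lemma ler_slope (R : realType) (a b c : R) :
  (forall t, 0 <= t -> t * a <= t * b + c) -> a <= b.
Proof.
move=> tab; rewrite leNgt; apply/negP => ba.
have d0 : 0 < a - b by lra.
have q0 : 0 <= (`|c| + 1) / (a - b) by rewrite divr_ge0 ?(ltW d0)// addr_ge0.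
have := tab _ q0; rewrite -lerBlDl -mulrBr divfK ?gt_eqF//.
by have := ler_norm c; lra.
Qed.

Section Functionals.
Context (R : realType) (E : normedModType R).
Implicit Types (l m n : {linear E -> R^o}) (w x y z : E) (t r : R).

Lemma linearZR l t z : l (t *: z) = t * l z.
Proof. by rewrite linearZ. Qed.

Lemma linear_norm_le l c : (forall z, l z <= `|z| + c) -> forall z, `|l z| <= `|z|.
Proof.
move=> lc; have lz z : l z <= `|z|.
  apply: (@ler_slope _ _ _ c) => t t0.
  by have := lc (t *: z); rewrite linearZR normrZ ger0_norm.
by move=> z; rewrite ler_norml lz andbT lerNl -linearN -normrN lz.
Qed.

Lemma linear_continuous_norm_le l :
  (forall z, `|l z| <= `|z|) -> continuous l.
Proof.
move=> ln; apply: (@bounded_linear_continuous R E R^o l).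
rewrite /bounded_near; near=> M.
have M1 : 1 <= M by near: M; exact: nbhs_pinfty_ge.
near=> z.
have z1 : `|z| < 1 by near: z; exact: nbhs0_lt.
exact: le_trans (ln z) (le_trans (ltW z1) M1).
Unshelve. all: by end_near. Qed.

Lemma dual_norm_le l c : (forall z, `|z| <= 1 -> `|l z| <= c) -> dual_norm l <= c.
Proof.
move=> lc; apply: ge_sup; last by move=> _ [z z1 <-]; exact: lc.
by exists `|l 0|, 0 => //=; rewrite normr0.
Qed.

Lemma le_dual_norm l z :
  (forall z, `|l z| <= `|z|) -> `|l z| <= dual_norm l * `|z|.
Proof.
move=> ln; have [->|z0] := eqVneq z 0.
  by rewrite linear0 !normr0 mulr0.
have nz : 0 < `|z| by rewrite normr_gt0.
rewrite -ler_pdivrMr//; apply: ub_le_sup.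
  by exists 1 => _ [y y1 <-]; rewrite (le_trans (ln y)).
exists (`|z|^-1 *: z) => /=.
  by rewrite normrZ normfV normr_id mulVf ?gt_eqF.
by rewrite linearZR normrM normfV normr_id mulrC.
Qed.

(** The supremum of a set without supremum is 0 by convention, so the value 1
    certifies that the set is bounded. *)
Lemma dual_sphere_has_sup l : dual_norm l = 1 ->
  has_sup [set `|l v| | v in [set v : E | `|v| <= 1]].
Proof.
move=> l1; apply: contrapT => /sup_out; rewrite -/(dual_norm l) l1 => /eqP.
by rewrite oner_eq0.
Qed.

Lemma dual_sphere_norm_le l z : dual_sphere l -> `|l z| <= `|z|.
Proof.
move=> [_ l1]; have [->|z0] := eqVneq z 0; first by rewrite linear0 !normr0.
have nz : 0 < `|z| by rewrite normr_gt0.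
rewrite -[leRHS]mul1r -l1 -ler_pdivrMr//; apply: ub_le_sup.
  exact: (dual_sphere_has_sup l1).2.
exists (`|z|^-1 *: z) => /=.
  by rewrite normrZ normfV normr_id mulVf ?gt_eqF.
by rewrite linearZR normrM normfV normr_id mulrC.
Qed.

Lemma dual_sphere_attain l e : dual_sphere l -> 0 < e ->
  exists2 u : E, `|u| <= 1 & 1 - e < l u.
Proof.
move=> [_ l1] e0; have hs := dual_sphere_has_sup l1.
have [_ [u u1 <-]] := sup_adherent e0 hs; rewrite -/(dual_norm l) l1.
have [l0|l0] := leP 0 (l u) => lu; first by exists u; rewrite // -(ger0_norm l0).
by exists (- u); [rewrite normrN|rewrite linearN -(ltr0_norm l0)].
Qed.

Lemma linear_ray l m r : exists n, forall z, n z = l z + r * (l z - m z).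
Proof. by exists (l \+ r \*: (l \- m)) => z. Qed.

(** The largest r that keeps l + r (l - m) in the unit ball puts it on the
    unit sphere. *)
Lemma dual_sphere_ray l m w :
  (forall z, `|l z| <= `|z|) -> (forall z, `|m z| <= `|z|) -> l w != m w ->
  exists2 r, 0 <= r &
    exists2 n, dual_sphere n & forall z, n z = l z + r * (l z - m z).
Proof.
move=> ln mn lmw.
pose S := [set r | 0 <= r /\ forall z, `|l z + r * (l z - m z)| <= `|z|].
have S0 : S 0 by split=> // z; rewrite mul0r addr0.
have d0 : 0 < `|l w - m w| by rewrite normr_gt0 subr_eq0.
have Sub : has_ubound S.
  exists (2 * `|w| / `|l w - m w|) => r [r0 /(_ w) Sr].
  rewrite ler_pdivlMr// -{1}(ger0_norm r0) -normrM.
  have := ler_normB (l w + r * (l w - m w)) (l w); have := ln w.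
  by rewrite addrAC subrr add0r; lra.
have Ssup : has_sup S by split=> //; exists 0.
pose r := sup S.
have r0 : 0 <= r by exact: ub_le_sup.
have [n nE] := linear_ray l m r.
have nn z : `|n z| <= `|z|.
  rewrite nE; apply/ler_addgt0Pr => e e0.
  pose c : R := `|l z - m z|.
  have c0 : 0 <= c by exact: normr_ge0.
  have c1 : 0 < c + 1 by lra.
  have e'0 : 0 < e / (c + 1) by exact: divr_gt0 e0 c1.
  have [r' Sr' rr'] := sup_adherent e'0 Ssup.
  have r'r : r' <= r by exact: ub_le_sup.
  have [_ /(_ z) r'z] := Sr'.
  have -> : l z + r * (l z - m z) =
    (l z + r' * (l z - m z)) + (r - r') * (l z - m z) by ring.
  rewrite (le_trans (ler_normD _ _))// lerD// normrM ger0_norm ?subr_ge0//.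
  have rr'e : r - r' <= e / (c + 1) by rewrite /r; lra.
  apply: le_trans (ler_wpM2r c0 rr'e) _.
  by rewrite mulrAC ler_pdivrMr// ler_pM2l//; lra.
exists r => //; exists n => //; split; first exact: linear_continuous_norm_le.
apply/eqP; rewrite eq_le; apply/andP; split.
  by apply: dual_norm_le => z; exact: le_trans (nn z).
rewrite leNgt; apply/negP => n1.
pose d := (1 - dual_norm n) / 2.
have dp : 0 < d by rewrite /d; lra.
suff : S (r + d) by move=> /(ub_le_sup Sub); rewrite -/r; lra.
split=> [|z]; first by rewrite addr_ge0// ltW.
have -> : l z + (r + d) * (l z - m z) = n z + d * (l z - m z).
  by rewrite nE; ring.
rewrite (le_trans (ler_normD _ _))// normrM (gtr0_norm dp).
have := le_dual_norm z nn.
have : `|l z - m z| <= 2 * `|z|.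
  by rewrite (le_trans (ler_normB _ _))//; have := ln z; have := mn z; lra.
move=> /(ler_wpM2l (ltW dp)).
have -> : dual_norm n = 1 - 2 * d by rewrite /d; lra.
lra.
Qed.

End Functionals.

(** * Polytopes and neighbourhoods *)

Section Polytopes.
Context (R : realType) (E : normedModType R).
Implicit Types (u v : R) (X : set E) (s : seq E) (a x y z : E).

Definition join_point a X : set E :=
  [set p.1 *: a + (1 - p.1) *: p.2 | p in `[0, 1]%classic `*` X].

(** Replaces weights that need not add up to 1, possibly both zero, by a single
    multiple of a point of X; used for joins and for infima over the cone of X. *)
Lemma convex_cone_add X u v x y : convex_set X -> 0 <= u -> 0 <= v ->
  X x -> X y -> exists2 z, X z & (u + v) *: z = u *: x + v *: y.
Proof.
move=> /convex_setP cX u0 v0 Xx Xy; have [uv0|uv0] := eqVneq (u + v) 0.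
  have [-> ->] : u = 0 /\ v = 0 by split; lra.
  by exists x => //; rewrite addr0 !scale0r addr0.
have uvp : 0 < u + v by rewrite lt_neqAle eq_sym uv0 addr_ge0.
exists ((u / (u + v)) *: x + (1 - u / (u + v)) *: y).
  apply: cX => //; first by rewrite divr_ge0// ltW.
  by rewrite ler_pdivrMr//; lra.
by rewrite scalerDr !scalerA; congr (_ *: _ + _ *: _); field.
Qed.

Lemma compact_join_point a X : compact X -> compact (join_point a X).
Proof.
move=> cX; apply: continuous_compact; last first.
  by apply: compact_setX => //; exact: segment_compact.
apply: continuous_subspaceT => -[t x] /=.
apply: cvgD; apply: cvgZ; try exact: cvg_cst.
- exact: cvg_fst.
- by apply: cvgB; [exact: cvg_cst|exact: cvg_fst].
- exact: cvg_snd.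
Qed.

Lemma convex_join_point a X : convex_set X -> convex_set (join_point a X).
Proof.
move=> cX; apply/convex_setP => k p q k0 k1.
move=> [[t x] [/= ti Xx] <-] [[t' x'] [/= ti' Xx'] <-].
move: ti ti'; rewrite /= !in_itv/= => /andP[t0 t1] /andP[t'0 t'1].
pose v := k * (1 - t); pose v' := (1 - k) * (1 - t').
have v0 : 0 <= v by rewrite mulr_ge0// subr_ge0.
have v'0 : 0 <= v' by rewrite mulr_ge0// subr_ge0.
have [y Xy yE] := convex_cone_add cX v0 v'0 Xx Xx'.
exists (1 - (v + v'), y).
  split=> //=; rewrite in_itv/= subr_ge0 gerBl addr_ge0// andbT.
  have vk : 0 <= k * t by rewrite mulr_ge0.
  have : 0 <= (1 - k) * t' by rewrite mulr_ge0// subr_ge0.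
  by rewrite /v /v'; lra.
rewrite /= subKr yE !scalerDr !scalerA -/v -/v' addrACA -scalerDl.
by congr (_ *: _ + _); rewrite /v /v'; ring.
Qed.

Fixpoint polytope s : set E :=
  if s is a :: s' then join_point a (polytope s') else [set 0].

Lemma mem_polytope s x : x \in s -> polytope s x.
Proof.
have ne s' : polytope s' !=set0.
  elim: s' => [|a s' [y sy]]; first by exists 0.
  exists a, (1, y) => /=; first by rewrite in_itv/= ler01 lexx.
  by rewrite subrr scale0r addr0 scale1r.
elim: s => // a s IH; rewrite inE => /predU1P[->|xs].
  have [y sy] := ne s; exists (1, y) => /=; first by rewrite in_itv/= ler01 lexx.
  by rewrite subrr scale0r addr0 scale1r.
exists (0, x) => /=; first by rewrite in_itv/= ler01 lexx; split=> //; exact: IH.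
by rewrite scale0r add0r subr0 scale1r.
Qed.

Lemma convex_polytope s : convex_set (polytope s).
Proof.
elim: s => [|a s]; last exact: convex_join_point.
by apply/convex_setP => t _ _ _ _ -> ->; rewrite !scaler0 addr0.
Qed.

Lemma compact_polytope s : compact (polytope s).
Proof. by elim: s => [|a s]; [exact: compact_set1|exact: compact_join_point]. Qed.

End Polytopes.

Section Neighbourhoods.
Context (R : realType) (E : normedModType R).
Implicit Types (f g : E -> R) (x y : E) (e : R).

Lemma sup_dist_lt f g e : (sup_dist f g < e%:E)%E -> forall x, `|f x - g x| < e.
Proof.
move=> fg x; rewrite -lte_fin; apply: le_lt_trans fg.
by apply: ereal_sup_ubound; exists x.
Qed.

Lemma sup_dist_le f g e : (forall x, `|f x - g x| <= e) -> (sup_dist f g <= e%:E)%E.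
Proof. by move=> fg; apply: ub_ereal_sup => _ [x _ <-]; rewrite lee_fin. Qed.

(** The form in which isolation is used: point-wise convergence to f within
    convex Katetov functions gives uniform approximation. *)
Lemma isolated_approx f (I : Type) (F : set_system I) (u : I -> E -> R) e :
  ProperFilter F -> KC_isolated f -> (forall i, KC [set: E] (u i)) ->
  (forall x, u i x @[i --> F] --> f x) -> 0 < e ->
  exists i, forall x, `|f x - u i x| < e.
Proof.
move=> FF isf KCu uf e0.
have : pointwise_nbhs f [set g | forall x, `|f x - g x| < e].
  by apply: isf; exists e => // g _; exact: sup_dist_lt.
have /(_ _)/[apply] : {ptws, u @ F --> f} by apply/pointwise_cvgP.
by move=> /(@filter_ex _ F FF)[i ui]; exists i; exact: ui (KCu i).
Qed.

(** Katetov functions are 1-Lipschitz, so closeness at a point of K extends to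
    a ball around it, and finitely many such balls cover K. *)
Lemma pointwise_nbhs_compact f (K : set E) e : KC [set: E] f ->
  compact K -> 0 < e ->
  pointwise_nbhs f [set g | forall x, K x -> `|f x - g x| < e].
Proof.
move=> /KC_TP[fL _ _] /compact_near_coveringP cK e0.
have e30 : 0 < e / 3 by rewrite divr_gt0.
pose F : set_system {ptws E -> R} :=
  within (KC [set: E]) (nbhs (f : {ptws E -> R})).
have FF : Filter F by apply: within_filter; exact: nbhs_filter.
apply: (cK {ptws E -> R} F (fun g x => `|f x - g x| < e) FF) => x _.
have xe : \forall y \near x, `|y - x| < e / 3.
  exact: (@cvgr_distC_lt _ _ _ (nbhs x) _ id x cvg_id _ e30).
have fe : \forall g \near F, KC [set: E] g /\ `|f x - g x| < e / 3.
  have fx : \forall g \near (f : {ptws E -> R}), `|f x - g x| < e / 3.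
    exact: (@pointwise_cvg_entourage E R x f _ (entourage_ball R (PosNum e30))).
  by apply: (@filterS _ (nbhs (f : {ptws E -> R})) _ _ _ _ fx) => g.
exists ([set y | `|y - x| < e / 3], [set g | KC [set: E] g /\ `|f x - g x| < e / 3]).
  by split.
move=> [y g] [/= xy [/KC_TP[gL _ _]]]; rewrite !ltr_norml => /andP[gx gx'].
have := fL y x; have := fL x y; have := gL y x; have := gL x y.
by rewrite (distrC x y) => *; apply/andP; split; lra.
Qed.

(** The approximating f_k may be replaced by f itself, since f_k coincides on
    X_k with its extension and is therefore close to f there. *)
Lemma local_attained f e : KC_local f -> 0 < e ->
  exists X : set E, [/\ X !=set0, convex_set X, compact X &
    forall y, exists2 x, X x & f x + `|x - y| < f y + e].
Proof.
move=> [X [u [Xu uf]]] e0; have e30 : 0 < e / 3 by rewrite divr_gt0.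
have : \forall k \near \oo, forall y, `|f y - inf_extension (X k) (u k) y| < e / 3.
  apply: (uf [set g | forall y, `|f y - g y| < e / 3]).
  apply/uniform_nbhs; exists [set p | `|p.1 - p.2| < e / 3]; split.
    exact: (entourage_ball R (PosNum e30)).
  by move=> g fg y; exact: fg.
move=> /filter_ex[k fk]; have [[a Xa] cX KX uX] := Xu k.
exists (X k); split=> //; first by exists a.
move=> y; have [x Xx xy] := inf_extension_lt Xa uX y e30.
exists x => //; move: xy (fk y) (fk x); rewrite (inf_extension_id Xa uX Xx).
by rewrite !ltr_norml => + /andP[? ?] /andP[? ?]; lra.
Qed.

End Neighbourhoods.

(** * Isolated, local and boundary-extreme functions *)

Section IsolatedNecessary.
Context (R : realType) (E : normedModType R).
Implicit Types (f g : E -> R) (x y z w : E) (e : R) (l : {linear E -> R^o}).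

(** The filter along which finite subsets of E increase. *)
Definition supersequences : set_system (seq E) :=
  [set A : set (seq E) | exists s0 : seq E, forall s : seq E, {subset s0 <= s} -> A s].

Lemma supersequences_filter : ProperFilter supersequences.
Proof.
apply: Build_ProperFilter => [[s0 s0F]|]; first exact: (s0F s0).
split=> [|A B [s sA] [s' s'B]|A B AB [s sA]].
- by exists [::].
- exists (s ++ s') => s1 s1P; split; [apply: sA|apply: s'B] => x xs; apply: s1P;
    by rewrite mem_cat xs ?orbT.
- by exists s => s1 /sA/AB.
Qed.

Lemma KC_restrict (X : set E) f : KC [set: E] f -> KC X f.
Proof.
move=> [kf /convex_functionP cf]; split=> [x y _ _|]; first exact: kf.
by apply/convex_functionP => t x y t0 t1 _ _; exact: cf.
Qed.

(** The functions f extended from polytopes converge point-wise to f because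
    each of them is eventually exact at any given point. *)
Lemma isolated_local f : KC [set: E] f -> KC_isolated f -> KC_local f.
Proof.
move=> fKC isf; have FF := supersequences_filter.
pose X (s : seq E) := polytope (0 :: s).
have X0 s : X s 0 by apply: mem_polytope; rewrite mem_head.
have fX s : KC (X s) f by exact: KC_restrict.
have approx n : exists s, forall x, `|f x - inf_extension (X s) f x| < n.+1%:R^-1.
  apply: (isolated_approx FF isf) => [s|x A /nbhs_singleton Afx|//].
    exact: KC_inf_extension (X0 s) (fX s) (@convex_polytope R E (0 :: s)).
  exists [:: x] => s xs /=; rewrite (inf_extension_id (X0 s) (fX s))//.
  by apply: mem_polytope; rewrite inE xs ?orbT// mem_head.
have [s sP] := choice approx.
exists (fun n => X (s n)), (fun=> f); split=> [n|].
  split=> //; first by exists 0.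
    exact: convex_polytope.
  exact: compact_polytope.
move=> P /uniform_nbhs[V [+ VP]]; rewrite -entourage_ballE => -[e /= e0 eV].
have : \forall n \near \oo, n.+1%:R^-1 < e by exact: near_infty_natSinv_lt (PosNum e0).
apply: filterS => n ne; apply: VP => x _; apply: eV => /=.
exact: lt_trans (sP n x) ne.
Qed.

(** The approximants max (g, (1 - eta) f) agree with g far away, and the value
    of l - g at any w0 is almost matched far away, at w0 + t v with l v close
    to 1. *)
Lemma isolated_boundary_extreme f :
  KC [set: E] f -> KC_isolated f -> boundary_extreme f.
Proof.
move=> fKC isf g gKC gf l lS; apply: ub_ereal_sup => _ [w0 _ <-].
have [fL fK cf] := (KC_TP f).1 fKC; have [gL gK cg] := (KC_TP g).1 gKC.
have f0 x : 0 <= f x by exact: (katetov_ge0 fKC.1).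
have g0 x : 0 <= g x by exact: (katetov_ge0 gKC.1).
apply/lee_addgt0Pr => e e0; have e20 : 0 < e / 2 by rewrite divr_gt0.
pose eta n : R := n.+1%:R^-1.
have eta0 n : 0 < eta n by rewrite invr_gt0.
have eta1 n : eta n <= 1 by rewrite invf_le1// ler1n.
pose u n x := Num.max (g x) ((1 - eta n) * f x).
have uKC n : KC [set: E] (u n).
  have t0 : 0 <= 1 - eta n by rewrite subr_ge0.
  apply: KC_max => // [x y|t x y t1 t2].
    have := ler_wpM2l t0 (fL x y).
    have : (1 - eta n) * `|x - y| <= `|x - y| by rewrite ler_piMl// gerBl ltW.
    by lra.
  by have := ler_wpM2l t0 (cf t x y t1 t2); lra.
have uf x : u n x @[n --> \oo] --> f x.
  apply: (@squeeze_cvgr _ \oo _ _ (fun n => (1 - eta n) * f x) (fun=> f x)).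
  - near=> n; rewrite le_max lexx orbT ge_max gf/=.
    by rewrite ler_piMl// gerBl ltW.
  - rewrite -[X in _ --> X]mul1r; apply: cvgM; last exact: cvg_cst.
    rewrite -[X in _ --> X]subr0; apply: cvgB; first exact: cvg_cst.
    exact: cvg_harmonic.
  - exact: cvg_cst.
have [n un] := isolated_approx _ isf uKC uf e20.
(* large enough for (1 - eta n) (f 0 + |w|) <= |w| - g 0 at w = w0 + t v *)
pose t := (f 0 + g 0) / eta n + `|w0| + e / 2 + 1.
have q0 : 0 <= (f 0 + g 0) / eta n by rewrite divr_ge0 ?addr_ge0// ltW.
have w00 := normr_ge0 w0.
have t0 : 0 < t by rewrite /t; lra.
have [v v1 lv] := dual_sphere_attain lS (divr_gt0 e20 t0).
have tlv : t - e / 2 <= t * l v.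
  by have := ler_wpM2l (ltW t0) (ltW lv); rewrite mulrBr mulr1 mulrC divfK ?gt_eqF.
pose w := w0 + t *: v.
have lw : l w = l w0 + t * l v by rewrite linearD linearZR.
have wt : t - e / 2 - `|w0| <= `|w|.
  have := dual_sphere_norm_le w lS; have := dual_sphere_norm_le w0 lS.
  by rewrite !ler_norml lw => /andP[? ?] /andP[? ?]; lra.
have gw : g w <= g w0 + t.
  have := gL w w0; rewrite /w addrAC subrr add0r normrZ (gtr0_norm t0).
  by have := ler_wpM2l (ltW t0) v1; lra.
have ug : u n w = g w.
  apply/max_idPl.
  have t10 : 0 <= 1 - eta n by rewrite subr_ge0.
  have fw : f w <= f 0 + `|w| by have := fL w 0; rewrite subr0.
  have gw' : `|w| - g 0 <= g w by have := gK w 0; rewrite subr0; lra.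
  apply: le_trans (ler_wpM2l t10 fw) _; apply: le_trans gw'.
  have : f 0 + g 0 <= eta n * `|w|.
    rewrite mulrC -ler_pdivrMr//; rewrite /t in wt; lra.
  by have := mulr_ge0 (ltW (eta0 n)) (f0 0); lra.
have fw : f w < g w + e / 2.
  by have := un w; rewrite ug ltr_norml => /andP[_]; lra.
apply: (@le_trans _ _ ((l w - f w)%:E + e%:E)%E).
  by rewrite -EFinD lee_fin; lra.
by rewrite leeD2r//; apply: ereal_sup_ubound; exists w.
Unshelve. all: by end_near. Qed.

End IsolatedNecessary.

Section IsolatedSufficient.
Context (R : realType) (E : normedModType R).
Implicit Types (f g : E -> R) (x y z w : E) (c d e : R).
Implicit Types (l m n : {linear E -> R^o}).

(** Extremality only speaks of functions below f. When g exceeds f by at most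
    d, the function min (f, g + d) still satisfies both Katetov inequalities,
    so its convex hull is a competitor. *)
Lemma boundary_extreme_approx f g d n c : KC [set: E] f -> KC [set: E] g ->
  boundary_extreme f -> 0 <= d -> (forall x, g x <= f x + d) -> dual_sphere n ->
  (forall x, n x - f x <= c) -> forall x, n x - g x <= c + d.
Proof.
move=> /KC_TP[fL fK _] /KC_TP[gL gK _] ef d0 gfd nS nc x.
pose k x := Num.min (f x) (g x + d).
have kL y z : k y <= k z + `|y - z|.
  by rewrite /k !minEle; have := fL y z; have := gL y z; do 2 case: ifPn; lra.
have kK y z : `|y - z| <= k y + k z.
  rewrite /k !minEle; have := fK y z; have := gK y z; have := gfd y.
  by have := gfd z; do 2 case: ifPn; lra.
have hk y : convex_hull_fun k y <= k y.
  exact: (convex_hull_fun_le kK (hull_epigraph_base _ y)).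
have hf y : convex_hull_fun k y <= f y.
  by rewrite (le_trans (hk y))// ge_min lexx.
have hg : convex_hull_fun k x <= g x + d.
  by rewrite (le_trans (hk x))// ge_min lexx orbT.
have := ef _ (KC_convex_hull_fun kL kK) hf n nS.
have : (conjugate f n <= c%:E)%E.
  by apply: ub_ereal_sup => _ [y _ <-]; rewrite lee_fin.
move=> fc /le_trans/(_ fc).
have : ((n x - convex_hull_fun k x)%:E <= conjugate (convex_hull_fun k) n)%E.
  by apply: ereal_sup_ubound; exists x.
by move=> /le_trans /[apply]; rewrite lee_fin; lra.
Qed.

(** The functional m is a subgradient at 0 of the convex function
    H w = inf over t >= 0 and x in X of g (w + t x) - t l x + t e. The
    hypothesis says that H 0 >= - c; t = 0 gives H <= g, hence the first
    conclusion, and w = - t x with t large gives the second. *)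
Lemma separating_functional g l X c e : KC [set: E] g ->
  convex_set X -> X !=set0 -> 0 <= e ->
  (forall t x, 0 <= t -> X x -> t * l x - c <= g (t *: x) + t * e) ->
  exists m, (forall x, m x <= g x + c) /\ (forall x, X x -> l x - m x <= e).
Proof.
move=> /KC_TP[gL gK cg] cX [a Xa] e0 gl.
pose P (p : R * E) := 0 <= p.1 /\ X p.2.
pose F w (p : R * E) := g (w + p.1 *: p.2) - p.1 * l p.2 + p.1 * e.
pose H w := inf [set F w p | p in [set p | P p]].
have P0 : P (0, a) by [].
have lb w p : P p -> - c - `|w| <= F w p.
  move=> [/= p0 Xp]; have := gl _ _ p0 Xp; rewrite /F.
  have := gL (p.1 *: p.2) (w + p.1 *: p.2).
  by rewrite opprD addrCA subrr addr0 normrN; lra.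
have H_le w t x : 0 <= t -> X x -> H w <= F w (t, x).
  by move=> t0 Xx; apply: (inf_image_le (lb w)).
have cH : convexT H.
  move=> t w w' t0 t1; apply/ler_addgt0Pr => d d0.
  have [[s x] [/= s0 Xx] Hw] := inf_image_lt P0 (lb w) d0.
  have [[s' x'] [/= s'0 Xx'] Hw'] := inf_image_lt P0 (lb w') d0.
  rewrite -/(H w) -/(H w') in Hw Hw'.
  have t10 : 0 <= 1 - t by lra.
  have ts0 := mulr_ge0 t0 s0; have ts'0 := mulr_ge0 t10 s'0.
  have [y Xy yE] := convex_cone_add cX ts0 ts'0 Xx Xx'.
  have := H_le (t *: w + (1 - t) *: w') _ _ (addr_ge0 ts0 ts'0) Xy.
  have := ler_wpM2l t0 (ltW Hw); have := ler_wpM2l t10 (ltW Hw').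
  have ly : (t * s + (1 - t) * s') * l y = t * s * l x + (1 - t) * s' * l x'.
    by rewrite -linearZR yE linearD !linearZR.
  have := cg t (w + s *: x) (w' + s' *: x') t0 t1.
  have -> : t *: (w + s *: x) + (1 - t) *: (w' + s' *: x') =
      t *: w + (1 - t) *: w' + (t * s + (1 - t) * s') *: y.
    by rewrite yE !scalerDr !scalerA addrACA.
  by rewrite /F/= ly; lra.
have [m mH] := convexT_subgradient 0 cH.
have H0 : - c <= H 0.
  by apply: (le_inf_image P0) => p /(lb 0); rewrite normr0 subr0.
exists m; split=> [w|x Xx].
  have := mH w; have := H_le w 0 a (lexx _) Xa.
  by rewrite /F/= scale0r !mul0r !addr0 subr0; lra.
apply: (@ler_slope _ _ _ (g 0 + c)) => t t0.
have := mH (- (t *: x)); have := H_le (- (t *: x)) t x t0 Xx.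
have -> : m (- (t *: x) - 0) = - (t * m x) by rewrite subr0 linearN linearZR.
by rewrite /F/= addNr; lra.
Qed.

(** The conjugate of g at the slope l of a subgradient of f is compared with
    that of f by writing l as a convex combination of a functional m, close to
    l on X, and of a functional n on the unit sphere. *)
Lemma local_boundary_extreme_isolated f : KC [set: E] f ->
  KC_local f -> boundary_extreme f -> KC_isolated f.
Proof.
move=> fKC lf ef N [eps eps0 epsN].
have [fL fK cf] := (KC_TP f).1 fKC.
have f0 x : 0 <= f x by exact: (katetov_ge0 fKC.1).
pose e := eps / 4; have e0 : 0 < e by rewrite divr_gt0.
have [X [X0 cX KX fX]] := local_attained lf e0.
(* beyond T the term t e compensates the loss 2 f 0 in |t x| - g 0; the
   summand 1 ensures that X itself is among the multiples considered *)
pose T := 2 * f 0 / e + 1.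
have T1 : 1 <= T by rewrite lerDr divr_ge0 ?mulr_ge0// ltW.
pose K := [set p.1 *: p.2 | p in `[0, T]%classic `*` X].
have KK : compact K.
  apply: continuous_compact; last first.
    by apply: compact_setX => //; exact: segment_compact.
  by apply: continuous_subspaceT => -[t x]; apply: cvgZ; [exact: cvg_fst|exact: cvg_snd].
have near_f := pointwise_nbhs_compact fKC KK e0.
suff main g : KC [set: E] g -> (forall x, K x -> `|f x - g x| < e) ->
    forall y, `|f y - g y| <= 3 * e.
  apply: (@filterS _ (nbhs (f : {ptws E -> R})) _ _ _ _ near_f) => g gK KCg.
  apply: epsN => //; apply: le_lt_trans (sup_dist_le (main g KCg (gK KCg))) _.
  by rewrite lte_fin /e; lra.
move=> gKC gf; have [gL gK cg] := (KC_TP g).1 gKC.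
have g_le y : g y <= f y + 2 * e.
  have [x Xx xy] := fX y; have := gL y x; rewrite (distrC y).
  have : K x.
    exists (1, x); last by rewrite /= scale1r.
    by rewrite /= in_itv/= ler01 T1.
  by move=> /gf; rewrite ltr_norml => /andP[? ?]; lra.
have tX t x : 0 <= t -> t <= T -> X x -> f (t *: x) <= g (t *: x) + e.
  move=> t0 tT Xx; have : K (t *: x).
    by exists (t, x) => //=; rewrite in_itv/= t0.
  by move=> /gf; rewrite ltr_norml => /andP[? ?]; lra.
move=> y.
have [l lf_le] := convexT_subgradient y cf.
pose c := l y - f y.
have lc z : l z - f z <= c by have := lf_le z; rewrite linearB /c; lra.
have ln : forall z, `|l z| <= `|z|.
  apply: (@linear_norm_le _ _ _ (f 0 + c)) => z.
  by have := lc z; have := fL z 0; rewrite subr0; lra.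
have c0 : - f 0 <= c by have := lc 0; rewrite linear0; lra.
have g0 : g 0 <= f 0 + e.
  have [x Xx] := X0; have : K 0.
    by exists (0, x); rewrite /= ?scale0r// in_itv/= lexx; split=> //; lra.
  by move=> /gf; rewrite ltr_norml => /andP[? ?]; lra.
have [|m [mg mX]] := separating_functional (l := l) (c := c + e) gKC cX X0 (ltW e0).
  move=> t x t0 Xx; rewrite -linearZR; have te0 := mulr_ge0 t0 (ltW e0).
  have [tT|Tt] := leP t T; first by have := lc (t *: x); have := tX t x t0 tT Xx; lra.
  have : 2 * f 0 <= t * e.
    by rewrite -ler_pdivrMr//; rewrite /T in Tt; lra.
  have := gK (t *: x) 0; have := ln (t *: x); rewrite subr0 ler_norml => /andP[_].
  by lra.
have mn : forall z, `|m z| <= `|z|.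
  apply: (@linear_norm_le _ _ _ (g 0 + (c + e))) => z.
  by have := mg z; have := gL z 0; rewrite subr0; lra.
suff : f y <= g y + 3 * e.
  by have := g_le y; rewrite ler_norml => *; apply/andP; split; lra.
have [lm|[w lmw]] : (forall w, l w = m w) \/ exists w, l w != m w.
  have [|h] := pselect (exists w, l w != m w); [by right|left=> w].
  by apply/eqP; apply: contrapT => /negP lw; apply: h; exists w.
  by have := mg y; rewrite -lm /c in mg *; lra.
have [r r0 [n nS nE]] := dual_sphere_ray ln mn lmw.
have nf x : n x - f x <= c + e + r * e.
  have [z Xz zx] := fX x.
  have := dual_sphere_norm_le (x - z) nS; rewrite distrC linearB ler_norml.
  move=> /andP[_]; have := ler_wpM2l r0 (mX z Xz); have := lc z.
  by have := nE z; lra.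
have d0 : 0 <= 2 * e by rewrite mulr_ge0// ltW.
(* convexity of the conjugate of g at (1 + r) l = n + r m *)
have := boundary_extreme_approx fKC gKC ef d0 g_le nS nf y.
have := ler_wpM2l r0 (mg y); rewrite nE => H1 H2.
have : (1 + r) * (f y) <= (1 + r) * (g y + 3 * e).
  by rewrite /c in H1 H2; have := mulr_ge0 r0 (ltW e0); lra.
by rewrite ler_pM2l//; lra.
Qed.

End IsolatedSufficient.

Theorem theorem5p7 (R : realType) (E : normedModType R) (f : E -> R)
    (hf : KC [set: E] f) :
  KC_isolated f <-> (KC_local f /\ boundary_extreme f).
Proof.
split=> [isf|[lf ef]]; last exact: local_boundary_extreme_isolated.
by split; [exact: isolated_local|exact: isolated_boundary_extreme].
Qed.
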